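(* Let $n\ge 5$ and let $\Sigma\subseteq\mathcal{E}_n=\mathrm{End}(\mathcal{T}_n)$. Then $\Sigma$ is a generating set for $\mathcal{E}_n$ if and only if $\Sigma$ contains a generating set for the group $\mathcal{G}_n=\mathrm{Aut}(\mathcal{T}_n)$ together with at least one element of each essential orbit. The minimal size of a generating set is therefore $3+r_3(n)+r_2(n)$, where $r_3(n)$ denotes the number of essential orbits (equivalently, orbits) of rank $3$ in $\mathcal{E}_n$ and $r_2(n)$ denotes the number of essential orbits of rank $2$ in $\mathcal{E}_n$.
   Context: $\mathcal{T}_n$ is the full transformation semigroup of all maps $\{1,\dots,n\}\to\{1,\dots,n\}$. $\mathcal{E}_n=\mathrm{End}(\mathcal{T}_n)$ is the monoid of all semigroup endomorphisms of $\mathcal{T}_n$ (not required to fix the identity map) under composition, where $\alpha\beta$ means first $\alpha$, then $\beta$. The rank of $\alpha\in\mathcal{E}_n$ is the cardinality of its image. The orbit of $\alpha\in\mathcal{E}_n$ is the set $\alpha\mathcal{G}_n=\{\alpha\psi:\psi\in\mathcal{G}_n\}$; all elements of an orbit have the same rank, called the rank of the orbit. The orbit of $\alpha$ is essential if $\alpha$ cannot be generated by (i.e. is not a product of one or more) elements of $\mathcal{E}_n$ of rank strictly greater than that of $\alpha$. (This does not depend on the choice of $\alpha$ in the orbit.) *)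

(* Defs.v *)
From HB Require Import structures.
From mathcomp Require Import all_boot all_fingroup.
From mathcomp Require Import boolp.

Set Implicit Arguments.
Unset Strict Implicit.
Unset Printing Implicit Defensive.

Local Open Scope group_scope.

(* All products below, in transf n as well as in endo n, are read from left
   to right: x * y is x followed by y. The endomorphisms of a semigroup and of
   its opposite are the same maps, so the choice made for transf n is
   immaterial. *)

Section FullTransformationSemigroup.
Variable n : nat.

Definition transf := {ffun 'I_n -> 'I_n}.

HB.instance Definition _ := Finite.on transf.

Definition transf_mul (f g : transf) : transf := [ffun i => g (f i)].
Definition transf_one : transf := [ffun i => i].

Fact transf_mulA : associative transf_mul.
Proof. by move=> f g h; apply/ffunP => i; rewrite !ffunE. Qed.

Fact transf_mul1 : left_id transf_one transf_mul.
Proof. by move=> f; apply/ffunP => i; rewrite !ffunE. Qed.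

Fact transf_mulr1 : right_id transf_one transf_mul.
Proof. by move=> f; apply/ffunP => i; rewrite !ffunE. Qed.

HB.instance Definition _ :=
  isMonoid.Build transf transf_mulA transf_mul1 transf_mulr1.

End FullTransformationSemigroup.

Section Endomorphisms.
Variable n : nat.
Local Notation T := (transf n).

(* Semigroup endomorphisms: the identity of transf n need not be fixed. *)
Record endo := Endo {
  endo_fun :> {ffun T -> T};
  _ : [forall f : T, forall g : T, endo_fun (f * g) == endo_fun f * endo_fun g]
}.

HB.instance Definition _ := [isSub for endo_fun].
HB.instance Definition _ := [Finite of endo by <:].

Fact endoM (a : endo) : {morph a : f g / f * g}.
Proof. by move=> f g; apply/eqP; move/forallP/(_ f)/forallP/(_ g): (valP a). Qed.

HB.instance Definition _ (a : endo) := isMultiplicative.Build T T a (@endoM a).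

Fact endo_mul_subproof (a b : endo) (c := [ffun f => b (a f)] : {ffun T -> T}) :
  [forall f : T, forall g : T, c (f * g) == c f * c g].
Proof. by apply/forallP => f; apply/forallP => g; rewrite !ffunE !endoM. Qed.

Definition endo_mul a b : endo := Endo (endo_mul_subproof a b).

Fact endo_one_subproof (c := [ffun f => f] : {ffun T -> T}) :
  [forall f : T, forall g : T, c (f * g) == c f * c g].
Proof. by apply/forallP => f; apply/forallP => g; rewrite !ffunE. Qed.

Definition endo_one : endo := Endo endo_one_subproof.

Fact endo_mulA : associative endo_mul.
Proof. by move=> a b c; apply/val_inj/ffunP => f; rewrite !ffunE. Qed.

Fact endo_mul1 : left_id endo_one endo_mul.
Proof. by move=> a; apply/val_inj/ffunP => f; rewrite !ffunE. Qed.

Fact endo_mulr1 : right_id endo_one endo_mul.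
Proof. by move=> a; apply/val_inj/ffunP => f; rewrite !ffunE. Qed.

HB.instance Definition _ :=
  isMonoid.Build endo endo_mulA endo_mul1 endo_mulr1.

(* An injective self-map of the finite type transf n is bijective. *)
Record auto := Auto { auto_endo :> endo; _ : injectiveb auto_endo }.

HB.instance Definition _ := [isSub for auto_endo].
HB.instance Definition _ := [Finite of auto by <:].

Fact auto_inj (a : auto) : injective a.
Proof. exact/injectiveP/(valP a). Qed.

Fact auto_mul_subproof (a b : auto) : injectiveb (auto_endo a * auto_endo b).
Proof.
by apply/injectiveP => f g; rewrite !ffunE => /auto_inj/auto_inj.
Qed.

Definition auto_mul (a b : auto) : auto := Auto (auto_mul_subproof a b).

Fact auto_one_subproof : injectiveb (1 : endo).
Proof. by apply/injectiveP => f g; rewrite !ffunE. Qed.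

Definition auto_one : auto := Auto auto_one_subproof.

Fact auto_inv_endo_subproof (a : auto)
    (c := [ffun f => invF (@auto_inj a) f] : {ffun T -> T}) :
  [forall f : T, forall g : T, c (f * g) == c f * c g].
Proof.
apply/forallP => f; apply/forallP => g; rewrite !ffunE; apply/eqP.
by apply: (@auto_inj a); rewrite endoM !f_invF.
Qed.

Fact auto_inv_subproof (a : auto) :
  injectiveb (Endo (auto_inv_endo_subproof a)).
Proof.
by apply/injectiveP => f g; rewrite !ffunE => /(can_inj (f_invF _)).
Qed.

Definition auto_inv (a : auto) : auto := Auto (auto_inv_subproof a).

Fact auto_mulA : associative auto_mul.
Proof. by move=> a b c; apply/val_inj/mulgA. Qed.

Fact auto_mul1 : left_id auto_one auto_mul.
Proof. by move=> a; apply/val_inj/mul1g. Qed.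

Fact auto_mulV : left_inverse auto_one auto_inv auto_mul.
Proof.
by move=> a; apply/val_inj/val_inj/ffunP => f; rewrite !ffunE f_invF.
Qed.

HB.instance Definition _ :=
  Finite_isGroup.Build auto auto_mulA auto_mul1 auto_mulV.

Implicit Types (a b : endo) (S : {set endo}).

Definition rank a : nat := #|[set a f | f : T]|.

Definition generated_by S a : Prop :=
  exists w : seq endo,
    [/\ w != [::], {subset w <= S} & a = \prod_(b <- w) b].

Definition generating S : Prop := forall a, generated_by S a.

Definition aut_orbit a : {set endo} := [set a * auto_endo p | p : auto].

Definition essential a : Prop :=
  ~ generated_by [set b : endo | rank a < rank b] a.

Definition essential_orbits : {set {set endo}} :=
  [set aut_orbit a | a : endo & `[< essential a >]].

Definition orbits_of_rank (k : nat) : {set {set endo}} :=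
  [set aut_orbit a | a : endo & rank a == k].

Definition essential_orbits_of_rank (k : nat) : {set {set endo}} :=
  [set aut_orbit a | a : endo & (rank a == k) && `[< essential a >]].

End Endomorphisms.

(* Main.v *)
Require Import Defs.
From mathcomp Require Import all_boot all_fingroup.
From mathcomp Require Import ssralg zmodp cyclic gseries alt boolp.

(** An endomorphism a of T_n, n >= 5, either separates the constant maps or
identifies all of them. If it separates them it is injective, because the
constant map at i times f is the constant map at f i, so that f can be read
off from these products; and it is then conjugation by a permutation. If it
identifies them, their common image z is a zero of the image of a. As the unit
group S_n then acts, through a, on at most n - 1 points, a is not injective on
S_n; the alternating group being simple, all even permutations are sent to
e = a 1, and the 2-transitivity of the alternating group forces every
non-injective map to z. So a factors through the three-element monoid of
parities: even permutations go to e, odd ones to some t with t * t = e, and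
the other maps to z ([noninj_endoE]).

Hence a non-automorphism has rank at most 3, and it is determined by its image
alone ([noninj_image_eq]): z is the zero and e the identity of the image, and
t is what remains. Consequently a * b = b as soon as b is not an automorphism
and rank (a * b) = rank b ([mul_noninj_same_rank]).

This settles which orbits are essential. Only automorphisms have rank more
than 3, so rank 3 is always essential. In rank 1, the endomorphism with
constant value e is a product of two of rank 2 unless e = 1, while the
constant endomorphism 1 is not a product of endomorphisms of rank at least 2
([const1_essential]); it is alone in its orbit. In rank 2, a product d * c
with d of rank 2 and c of rank 3 has the same image as h * c for a suitable h of rank 3, hence
is not essential ([rank2_mul_rank3]). Together these facts say that when a
product a * b is essential, one of its factors lies in its orbit
([essential_mul]), which gives the necessity of the criterion by induction on
words; sufficiency is a downward induction on the rank. The count then adds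
the two generators needed for Aut T_n, a non-cyclic copy of S_n generated by a
transposition and an n-cycle, the single essential orbit of rank 1, and the
essential orbits of ranks 2 and 3. *)

Set Implicit Arguments.
Unset Strict Implicit.
Unset Printing Implicit Defensive.

Local Open Scope group_scope.

(** * Transformations and their parity *)

Section Transformations.
Variable n : nat.
Implicit Types (f g : transf n) (i j : 'I_n) (s t : 'S_n).

Lemma transfM f g i : (f * g) i = g (f i).
Proof. by rewrite ffunE. Qed.

Lemma transf1 i : (1 : transf n) i = i.
Proof. by rewrite ffunE. Qed.

Definition const_transf i : transf n := [ffun=> i].

Lemma const_transfM i f : const_transf i * f = const_transf (f i).
Proof. by apply/ffunP => j; rewrite transfM !ffunE. Qed.

Lemma mul_const_transf f i : f * const_transf i = const_transf i.
Proof. by apply/ffunP => j; rewrite transfM !ffunE. Qed.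

Lemma transf_right_zero f :
  (forall g, g * f = f) -> forall i, f = const_transf (f i).
Proof.
move=> fz i; apply/ffunP => j.
by rewrite -{1}(fz (const_transf i)) transfM !ffunE.
Qed.

Definition perm_transf s : transf n := [ffun i => s i].

Lemma perm_transfM : {morph perm_transf : s t / s * t}.
Proof. by move=> s t; apply/ffunP => i; rewrite transfM !ffunE permM. Qed.

Lemma perm_transf1 : perm_transf 1 = 1.
Proof. by apply/ffunP => i; rewrite !ffunE perm1. Qed.

Lemma perm_transf_inj : injective perm_transf.
Proof.
by move=> s t /ffunP st; apply/permP => i; move: (st i); rewrite !ffunE.
Qed.

Lemma perm_transf_is_inj s : injective (perm_transf s).
Proof. by move=> i j; rewrite !ffunE => /perm_inj. Qed.

Lemma inj_transfP f : injective f -> exists s, f = perm_transf s.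
Proof.
by move=> fI; exists (perm fI); apply/ffunP => i; rewrite ffunE permE.
Qed.

Lemma inj_idem_transf f : injective f -> f * f = f -> f = 1.
Proof.
move=> fI ff; apply/ffunP => i; apply: fI.
by rewrite transf1 -transfM ff.
Qed.

(** For i <> j, the idempotents of rank n - 1 through which every non-injective
map factors, see [merge_transfM]. *)
Definition merge_transf i j : transf n := [ffun k => if k == i then j else k].

Lemma merge_transf_idem i j :
  merge_transf i j * merge_transf i j = merge_transf i j.
Proof.
apply/ffunP => k; rewrite transfM !ffunE.
by case: (k =P i) => [_|/eqP/negPf->//]; rewrite if_same.
Qed.

Lemma merge_transfM i j f : f i = f j -> merge_transf i j * f = f.
Proof.
by move=> fij; apply/ffunP => k; rewrite transfM ffunE; case: eqP => // ->.
Qed.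

Lemma merge_transf_noninj i j : i != j -> ~ injective (merge_transf i j).
Proof.
move=> ij /(_ i j); rewrite !ffunE eqxx if_same => /(_ erefl) /eqP.
by rewrite (negPf ij).
Qed.

Lemma noninj_transfP f : ~ injective f -> exists i j, i != j /\ f i = f j.
Proof.
move=> /injectiveP/injectivePn [i [j ij fij]].
by exists i, j.
Qed.

Lemma noninj_transfMl f g : ~ injective f -> ~ injective (f * g).
Proof.
by move=> fN fgI; apply: fN => i j e; apply: fgI; rewrite !transfM e.
Qed.

Lemma noninj_transfMr f g : ~ injective g -> ~ injective (f * g).
Proof.
move=> gN fgI; apply: gN; have /inj_transfP [s fs]: injective f.
  by move=> i j e; apply: fgI; rewrite !transfM e.
move=> i j e; apply: (can_inj (permK s^-1)); apply: fgI.
by rewrite !transfM fs !ffunE !permKV.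
Qed.

Lemma noninj_const_transf i : 1 < n -> ~ injective (const_transf i).
Proof.
move=> n_gt1 /(_ (Ordinal (ltnW n_gt1)) (Ordinal n_gt1)).
by rewrite !ffunE => /(_ erefl) [].
Qed.

(** The quotient of T_n onto the three-element monoid: [None] is its zero, taken
on non-injective maps. *)
Definition parity f : option bool :=
  omap (@odd_perm _) [pick s | perm_transf s == f].

Lemma parity_perm s : parity (perm_transf s) = Some (odd_perm s).
Proof.
rewrite /parity; case: pickP => [t /eqP/perm_transf_inj-> //|/(_ s)].
by rewrite eqxx.
Qed.

Lemma parity_noninj f : ~ injective f -> parity f = None.
Proof.
rewrite /parity; case: pickP => // s /eqP <- [].
exact: perm_transf_is_inj.
Qed.

Lemma parity1 : parity 1 = Some false.
Proof. by rewrite -perm_transf1 parity_perm odd_perm1. Qed.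

Lemma parityM f g :
  parity (f * g) = obind (fun b => omap (addb b) (parity g)) (parity f).
Proof.
have [/inj_transfP [s ->]|fN] := pselect (injective f); last first.
  by rewrite (parity_noninj fN) parity_noninj //; apply: noninj_transfMl.
have [/inj_transfP [t ->]|gN] := pselect (injective g); last first.
  rewrite (parity_noninj gN) parity_noninj; last exact: noninj_transfMr.
  by case: parity.
by rewrite -perm_transfM !parity_perm /= odd_permM.
Qed.

End Transformations.

Arguments const_transf {n} i.

(** * Ranks, orbits and generation *)

Section EndoBasics.
Variable n : nat.
Implicit Types (a b : endo n) (f g : transf n) (p q : auto n).

Lemma endo_mulE a b f : (a * b) f = b (a f).
Proof. by rewrite ffunE. Qed.

Lemma endoP a b : (forall f, a f = b f) -> a = b.
Proof. by move=> ab; apply/val_inj/ffunP. Qed.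

Lemma endo1 f : (1 : endo n) f = f.
Proof. by rewrite ffunE. Qed.

Lemma endoXX a : a 1 * a 1 = a 1.
Proof. by rewrite -endoM mulg1. Qed.

Lemma autoP a : injective a -> exists p, a = auto_endo p.
Proof. by move=> /injectiveP aI; exists (Auto aI). Qed.

Lemma auto_endoM p q : auto_endo (p * q) = auto_endo p * auto_endo q.
Proof. by []. Qed.

Lemma auto_endo_inj : injective (@auto_endo n).
Proof. exact: val_inj. Qed.

Lemma auto_surj p f : exists g, f = p g.
Proof. by exists (p^-1 f); rewrite -endo_mulE -auto_endoM mulVg endo1. Qed.


Definition endo_image a : {set transf n} := [set a f | f : transf n].

Lemma rankE a : rank a = #|endo_image a|. Proof. by []. Qed.

Lemma endo_image_mem a f : a f \in endo_image a.
Proof. exact: imset_f. Qed.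

Lemma endo_imageP a f : reflect (exists g, f = a g) (f \in endo_image a).
Proof. by apply: (iffP imsetP) => [[g _ ->]|[g ->]]; exists g. Qed.

Lemma endo_image_mul a b : endo_image (a * b) = b @: endo_image a.
Proof.
rewrite /endo_image -imset_comp; apply: eq_imset => f /=.
by rewrite endo_mulE.
Qed.

Lemma endo_image_mul_sub a b : endo_image (a * b) \subset endo_image b.
Proof.
by apply/subsetP => f /endo_imageP [g ->]; rewrite endo_mulE endo_image_mem.
Qed.

Lemma rank_mull a b : rank (a * b) <= rank a.
Proof. by rewrite !rankE endo_image_mul leq_imset_card. Qed.

Lemma rank_mulr a b : rank (a * b) <= rank b.
Proof. by rewrite !rankE subset_leq_card ?endo_image_mul_sub. Qed.

Lemma rank_mul_auto a p : rank (a * p) = rank a.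
Proof. by rewrite !rankE endo_image_mul card_imset //; apply: auto_inj. Qed.

Lemma rank_max a : rank a <= #|transf n|.
Proof. exact: max_card. Qed.

Lemma rank_inj a : injective a <-> rank a = #|transf n|.
Proof.
split=> [aI|e]; first by rewrite /rank card_imset.
by have /imset_injP aI : #|[set a f | f : transf n]| == #|transf n|;
  [rewrite -/(rank a) e | move=> f g; apply: aI].
Qed.

Lemma aut_orbitP a b :
  reflect (exists p, b = a * auto_endo p) (b \in aut_orbit a).
Proof. by apply: (iffP imsetP) => [[p _ ->]|[p ->]]; exists p. Qed.

Lemma aut_orbit_refl a : a \in aut_orbit a.
Proof. by apply/aut_orbitP; exists 1; rewrite mulg1. Qed.

Lemma aut_orbit_sym a b : b \in aut_orbit a -> a \in aut_orbit b.
Proof.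
case/aut_orbitP => p ->; apply/aut_orbitP; exists p^-1.
by rewrite -mulgA -auto_endoM mulgV mulg1.
Qed.

Lemma aut_orbit_trans a b c :
  b \in aut_orbit a -> c \in aut_orbit b -> c \in aut_orbit a.
Proof.
case/aut_orbitP => p -> /aut_orbitP [q ->]; apply/aut_orbitP; exists (p * q).
by rewrite auto_endoM mulgA.
Qed.

Lemma aut_orbit_eq a b : b \in aut_orbit a -> aut_orbit b = aut_orbit a.
Proof.
move=> ba; apply/setP => c; apply/idP/idP; first exact: aut_orbit_trans.
exact/aut_orbit_trans/aut_orbit_sym.
Qed.

Lemma aut_orbit_rank a b : b \in aut_orbit a -> rank b = rank a.
Proof. by case/aut_orbitP => p ->; rewrite rank_mul_auto. Qed.

Lemma generated_mem (S : {set endo n}) a : a \in S -> generated_by S a.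
Proof.
move=> aS; exists [:: a]; split; rewrite ?big_seq1 // => b.
by rewrite inE => /eqP ->.
Qed.

Lemma generated_mul (S : {set endo n}) a b :
  generated_by S a -> generated_by S b -> generated_by S (a * b).
Proof.
move=> [v [v0 vS ->]] [w [w0 wS ->]]; exists (v ++ w); split.
- by case: v v0 {vS}.
- by move=> c; rewrite mem_cat => /orP [/vS|/wS].
- by rewrite big_cat.
Qed.

Lemma generated_ind (S : {set endo n}) (P : endo n -> Prop) :
  (forall a, a \in S -> P a) ->
  (forall a b, a \in S -> P b -> P (a * b)) ->
  forall a, generated_by S a -> P a.
Proof.
move=> PS PM _ [w [w0 wS ->]]; elim: w w0 wS => // a [|b w] IH _ wS.
  by rewrite big_seq1; apply/PS/wS/mem_head.
rewrite big_cons; apply: PM; first exact/wS/mem_head.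
by apply: IH => // c cw; apply: wS; rewrite inE cw orbT.
Qed.

Lemma generated_trans (S S' : {set endo n}) a :
  (forall b, b \in S' -> generated_by S b) ->
  generated_by S' a -> generated_by S a.
Proof.
move=> SS'; apply: generated_ind => // b c /SS' Sb Sc.
exact: generated_mul.
Qed.

Lemma generated_above a :
  generated_by [set b | rank a < rank b] a -> rank a < #|transf n|.
Proof.
case=> -[|c w] [//= _ /(_ c (mem_head _ _))]; rewrite inE => lt_a _.
exact: leq_trans lt_a (rank_max c).
Qed.

(** Right multiplication by an automorphism can be undone, and an automorphism
is itself among the endomorphisms of higher rank. *)
Lemma essential_orbit a b : b \in aut_orbit a -> essential a -> essential b.
Proof.
move=> ba ea gb; apply: ea; have /aut_orbitP [p ap] := aut_orbit_sym ba.
have rab : rank a = rank b by rewrite ap rank_mul_auto.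
rewrite rab {1}ap; apply: generated_mul (gb) _; apply: generated_mem.
by rewrite inE; have /rank_inj -> := @auto_inj n p; apply: generated_above gb.
Qed.

Lemma rank_gt0 a : 0 < rank a.
Proof. by apply/card_gt0P; exists (a 1); apply: endo_image_mem. Qed.

Lemma rank_gt1P a : 1 < rank a <-> exists f g, a f != a g.
Proof.
split=> [/card_gt1P [_ [_ [/endo_imageP [f ->] /endo_imageP [g ->] fg]]]|].
  by exists f, g.
case=> f [g fg]; apply/card_gt1P; exists (a f), (a g).
by rewrite !endo_image_mem.
Qed.

Lemma rank_const a f : (forall g, a g = f) -> rank a = 1%N.
Proof.
move=> af; apply/eqP; rewrite eqn_leq rank_gt0 andbT leqNgt.
by apply/negP => /rank_gt1P [g [h]]; rewrite !af eqxx.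
Qed.

End EndoBasics.

(** * Endomorphisms that are not automorphisms *)

Lemma exists_notin n (A : {set 'I_n}) : #|A| < n -> exists i, i \notin A.
Proof.
move=> An; apply/existsP; rewrite -negb_forall; apply/negP => /forallP all_in.
have : #|'I_n| <= #|A| by apply/subset_leq_card/subsetP.
by rewrite card_ord leqNgt An.
Qed.

Section Points.
Variable n : nat.
Hypothesis n_ge5 : 4 < n.

Definition point k (k_lt5 : k < 5) : 'I_n := Ordinal (leq_trans k_lt5 n_ge5).

Lemma point_eq j k (j_lt5 : j < 5) (k_lt5 : k < 5) :
  (point j_lt5 == point k_lt5) = (j == k).
Proof. by []. Qed.

Lemma noninj_const i : ~ injective (@const_transf n i).
Proof. by apply/noninj_const_transf/(ltn_trans _ n_ge5). Qed.

(** For a non-injective [a], all constant maps give the same value, and so do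
all odd permutations. *)
Definition zero_of (a : endo n) := a (const_transf (point (isT : 0 < 5))).
Definition odd_of (a : endo n) :=
  a (perm_transf (tperm (point (isT : 0 < 5)) (point (isT : 1 < 5)))).

End Points.

Section Collapse.
Variable n : nat.
Hypothesis n_ge5 : 4 < n.
Variable a : endo n.
Hypothesis aN : ~ injective a.
Implicit Types (f g : transf n) (i j : 'I_n) (s t : 'S_n).
Local Notation z := (zero_of n_ge5 a).

(** If a f = a g with f k <> g k, then a identifies the constant maps at f k and
at g k; multiplying on the right moves these two points to any others. *)
Lemma noninj_endo_const i j : a (const_transf i) = a (const_transf j).
Proof.
have /injectiveP/injectivePn [f [g fg afg]] := aN.
have [k fgk] : exists k, f k <> g k.
  apply: contra_notP (elimN eqP fg) => fgE; apply/ffunP => k.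
  by apply: contra_notP fgE; exists k.
pose h : transf n := [ffun x => if x == f k then i else j].
have -> : i = h (f k) by rewrite ffunE eqxx.
have -> : j = h (g k) by rewrite ffunE; case: eqP => // /esym.
by rewrite -!const_transfM !endoM afg.
Qed.

Lemma zero_ofMr f : a f * z = z.
Proof. by rewrite -endoM mul_const_transf. Qed.

Lemma zero_ofMl f : z * a f = z.
Proof. by rewrite -endoM const_transfM; apply: noninj_endo_const. Qed.

Let K := [set s | a (perm_transf s) == a 1].

Lemma kernel_group_set : group_set K.
Proof.
apply/group_setP; split=> [|s t]; first by rewrite inE perm_transf1.
by rewrite !inE perm_transfM endoM => /eqP-> /eqP->; rewrite endoXX.
Qed.
Canonical kernel_group := Group kernel_group_set.

Lemma kernel_normal : K <| [set: 'S_n].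
Proof.
rewrite /normal subsetT; apply/subsetP => s _.
rewrite inE; apply/subsetP => u /imsetP [t]; rewrite inE => /eqP tK -> {u}.
rewrite inE /conjg !perm_transfM !endoM tK -!endoM mul1g -perm_transfM.
by rewrite mulVg perm_transf1.
Qed.

(** Put e = a 1. Every a (perm_transf s) permutes the fixed points of e and is
determined by that permutation; moreover it fixes each point j of the image of
the zero z. This leaves only (n - 1)! values for n! permutations s. *)
Lemma kernel_nontrivial : exists2 s, s \in K & s != 1.
Proof.
pose e := a 1; pose j := z (point n_ge5 (isT : 0 < 5)).
have ee : e * e = e by apply: endoXX.
have aVs s i : e i = i -> a (perm_transf s^-1) (a (perm_transf s) i) = i.
  by move=> ei; rewrite -transfM -endoM -perm_transfM mulgV perm_transf1.
have eas s i : e (a (perm_transf s) i) = a (perm_transf s) i.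
  by rewrite -transfM -endoM mulg1.
(* a (perm_transf s), restricted to the fixed points of e and extended to a
   permutation of all points. *)
pose P s i := if e i == i then a (perm_transf s) i else i.
have PI s : injective (P s).
  move=> x y; rewrite /P; case: eqP => ex; case: eqP => ey //.
  - by move=> /(congr1 (a (perm_transf s^-1))); rewrite !aVs.
  - by move=> xy; case: ey; rewrite -xy eas.
  - by move=> xy; case: ex; rewrite xy eas.
pose Q s : 'S_n := perm (@PI s).
have Qj s : Q s \in perm_on [set~ j].
  apply/subsetP => x; rewrite !inE permE /P; apply: contraNneq => ->.
  by rewrite /j -!transfM !zero_ofMl eqxx.
have QI : ~ injective Q.
  move=> QI; have : #|Q @: [set: 'S_n]| <= #|perm_on [set~ j]|.
    apply/subset_leq_card/subsetP => _ /imsetP [s _ ->]; exact: Qj.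
  rewrite card_imset // cardsT card_Sn card_perm cardsC1 card_ord.
  case: (n) n_ge5 => // m m_ge.
  rewrite factS -[leqRHS]mul1n leq_pmul2r ?fact_gt0 //.
  by case: m m_ge.
have /injectiveP/injectivePn [s [t st Qst]] := QI.
exists (s * t^-1); last first.
  by apply: contra st => /eqP/(canRL (mulgKV _)); rewrite mul1g => ->.
rewrite inE; apply/eqP.
suff est : a (perm_transf s) = a (perm_transf t).
  by rewrite perm_transfM endoM est -endoM -perm_transfM mulgV perm_transf1.
apply/ffunP => i.
rewrite -(mul1g (perm_transf s)) -(mul1g (perm_transf t)) !endoM !transfM.
have /permP/(_ (e i)) := Qst; rewrite !permE /P.
by rewrite -/e -(transfM e e) ee eqxx.
Qed.

(** The kernel meets the simple group Alt_n in a normal subgroup. If that were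
trivial, the commutators of a nontrivial k in the kernel with all permutations,
being even elements of the kernel, would be trivial; but k does not commute
with a transposition that moves k x and fixes x. *)
Lemma kernel_Alt : 'Alt_('I_n) \subset K.
Proof.
have cardn : 4 < #|'I_n| by rewrite card_ord.
have /simpleP [_ altS] := simple_Alt5 cardn.
have nK : (K :&: 'Alt_('I_n))%G <| 'Alt_('I_n).
  rewrite /normal subsetIr normsI ?normG //.
  by apply: subset_trans (normal_norm kernel_normal); apply: subsetT.
have [/= KA1|/= KA] := altS _ nK; last by rewrite -KA subsetIl.
have [k kK k1] := kernel_nontrivial.
have [x kx] : exists x, k x != x.
  apply: contra_notP (elimN eqP k1) => kN; apply/permP => x; rewrite perm1.
  by apply: contra_notP kN => /eqP; exists x.
have [|y] := @exists_notin n [set x; k x].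
  by rewrite cards2 (leq_trans _ n_ge5) //; case: eqP.
rewrite !inE negb_or => /andP [yx ykx].
have : [~ k, tperm (k x) y] \in K :&: 'Alt_('I_n).
  apply/setIP; split.
    rewrite commgEl groupM ?groupV //= memJ_norm //.
    by apply: (subsetP (normal_norm kernel_normal)); rewrite inE.
  rewrite Alt_even commgEl /conjg !odd_permM !odd_permV odd_tperm.
  by case: odd_perm; case: (_ != _).
rewrite KA1 inE => /commgP/permP/(_ x).
rewrite !permM tpermL tpermD // 1?eq_sym //.
by move=> e; rewrite e eqxx in ykx.
Qed.

Lemma noninj_endo_even s : ~~ odd_perm s -> a (perm_transf s) = a 1.
Proof.
move=> es; have /(subsetP kernel_Alt) : s \in 'Alt_('I_n) by rewrite Alt_even.
by rewrite inE => /eqP.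
Qed.

Lemma even_perm_2transitive (x y u v : 'I_n) : x != y -> u != v ->
  exists s : 'S_n, [/\ ~~ odd_perm s, s x = u & s y = v].
Proof.
move=> xy uv; pose s := tperm x u * tperm (tperm x u y) v.
have sx : s x = u.
  rewrite permM tpermL tpermD //; last by rewrite eq_sym.
  by rewrite -(inj_eq (@perm_inj _ (tperm x u))) tpermK tpermR eq_sym.
have sy : s y = v by rewrite permM tpermL.
have [|c cuv] := @exists_notin n [set u; v].
  by rewrite cards2 (leq_trans _ n_ge5) //; case: eqP.
have [|d] := @exists_notin n (c |: [set u; v]).
  by rewrite cardsU1 cuv cards2 (leq_trans _ n_ge5) //; case: eqP.
move: cuv; rewrite !inE !negb_or => /andP [cu cv] /and3P [dc du dv].
case: (boolP (odd_perm s)) => os; last by exists s.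
(* A transposition off u and v corrects the sign. *)
exists (s * tperm c d).
rewrite odd_permM odd_tperm os eq_sym dc; split => //.
- by rewrite permM sx tpermD.
- by rewrite permM sy tpermD.
Qed.

(** Let f merge i and j. If g has the same image under a as f and takes two
values x and y, choose an even s moving these values to i and j: then
g * s * f has smaller rank than g, and still the image of f * f = f under a.
Descending, one reaches a constant map. *)
Lemma noninj_endo_merge i j : i != j -> a (merge_transf i j) = z.
Proof.
move=> ij; set f := merge_transf i j.
pose i0 := point n_ge5 (isT : 0 < 5).
suff descent m g : #|g @: [set: 'I_n]| <= m -> a g = a f -> a f = z.
  by apply: (descent _ f (leqnn _)).
elim: m g => [|m IH] g.
  rewrite leqn0 cards_eq0 => /eqP/setP/(_ (g i0)).
  by rewrite imset_f !inE.
move=> gm ag.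
have [[x [y gxy]]|gC] := pselect (exists x y, g x != g y); last first.
  rewrite -ag /zero_of (noninj_endo_const _ (g i0)); congr (a _).
  apply/ffunP => x; rewrite ffunE; apply: contra_notP gC => /eqP gx.
  by exists x, i0.
have [s [es sx sy]] := even_perm_2transitive gxy ij.
have sfE : #|[set (perm_transf s * f) u | u in g @: [set: 'I_n]]|
           < #|g @: [set: 'I_n]|.
  rewrite ltn_neqAle leq_imset_card andbT; apply/negP => /imset_injP.
  move/(_ (g x) (g y) (imset_f _ (in_setT _)) (imset_f _ (in_setT _))).
  rewrite !transfM !(ffunE (fun i => s i)) sx sy !ffunE.
  rewrite eqxx if_same => /(_ erefl) e.
  by rewrite e eqxx in gxy.
apply: (IH (g * (perm_transf s * f))); last first.
  by rewrite !endoM noninj_endo_even // ag -!endoM mul1g merge_transf_idem.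
rewrite -ltnS (leq_trans _ gm) // (leq_trans _ sfE) // ltnS -imset_comp.
apply/subset_leq_card/subsetP => _ /imsetP [u _ ->].
by apply/imsetP; exists u; rewrite ?in_setT // /= 3!ffunE.
Qed.

Lemma noninj_endo_singular f : ~ injective f -> a f = z.
Proof.
move=> /noninj_transfP [i [j [ij fij]]].
by rewrite -(merge_transfM fij) endoM noninj_endo_merge // zero_ofMl.
Qed.

End Collapse.

Section Singular.
Variable n : nat.
Hypothesis n_ge5 : 4 < n.
Implicit Types (a b c d : endo n) (f g : transf n) (s : 'S_n) (p : auto n).

Local Notation pt k := (@point n n_ge5 k isT).
Local Notation zero_of := (zero_of n_ge5).
Local Notation odd_of := (odd_of n_ge5).

Definition on_parity f e t z : transf n :=
  if parity f is Some b then (if b then t else e) else z.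

Lemma noninj_endoE a f :
  ~ injective a -> a f = on_parity f (a 1) (odd_of a) (zero_of a).
Proof.
move=> aN; rewrite /on_parity.
have [/inj_transfP [s ->]|fN] := pselect (injective f); last first.
  by rewrite parity_noninj //; apply: noninj_endo_singular.
rewrite parity_perm; case: (boolP (odd_perm s)) => os; last first.
  exact: noninj_endo_even.
set u := tperm (pt 0) (pt 1).
have -> : s = s * u^-1 * u by rewrite -mulgA mulVg mulg1.
rewrite perm_transfM endoM.
rewrite noninj_endo_even //; first by rewrite -endoM mul1g.
by rewrite odd_permM odd_permV odd_tperm point_eq os.
Qed.

Lemma odd_ofX a : odd_of a * odd_of a = a 1.
Proof. by rewrite -endoM -perm_transfM tperm2 perm_transf1. Qed.

Lemma odd_of_zero a : ~ injective a -> odd_of a * zero_of a = zero_of a.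
Proof. by move=> aN; apply: zero_ofMr. Qed.

Lemma zero_of_idem a : zero_of a * zero_of a = zero_of a.
Proof. by rewrite -endoM mul_const_transf. Qed.

Lemma image_noninj a :
  ~ injective a -> endo_image a = [set a 1; odd_of a; zero_of a].
Proof.
move=> aN; apply/setP => f; rewrite !inE; apply/idP/idP.
  case/endo_imageP => g ->; rewrite (noninj_endoE g aN) /on_parity.
  by case: parity => [[]|]; rewrite eqxx ?orbT.
by case/orP => [/orP []|] /eqP ->; apply: endo_image_mem.
Qed.

Lemma rank_noninj a : ~ injective a -> rank a <= 3.
Proof.
move=> aN; rewrite rankE image_noninj // (leq_trans (leq_card_setU _ _)) //.
by rewrite cards1 cards2; case: eqP.
Qed.

Lemma card_transf_gt3 : 3 < #|transf n|.
Proof.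
rewrite card_ffun card_ord (leq_trans (ltnW n_ge5)) // -{1}(expn1 n).
by rewrite leq_pexp2l // (leq_trans _ n_ge5).
Qed.

Lemma rank_gt3 a : 3 < rank a <-> injective a.
Proof.
split=> [|/rank_inj ->]; last exact: card_transf_gt3.
by apply: contraPP => /rank_noninj; rewrite leqNgt => /negP.
Qed.

(** Any other coincidence among e, t and z would also give t = e, by t * t = e
and t * e = t. *)
Lemma odd_neq_rank a : ~ injective a -> odd_of a != a 1 -> rank a = 3.
Proof.
move=> aN te; have tz : odd_of a != zero_of a.
  apply: contra te => /eqP tz; rewrite -odd_ofX {3}tz.
  by rewrite odd_of_zero // tz.
have ez : a 1 != zero_of a.
  apply: contra tz => /eqP ez.
  rewrite /odd_of -(mulg1 (perm_transf _)) endoM ez.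
  by rewrite odd_of_zero.
rewrite rankE image_noninj // setUC cardsU1 !inE negb_or.
by rewrite eq_sym ez eq_sym tz cards2 eq_sym te.
Qed.

(** In the common image, z is the zero and e the identity; t is then the
remaining element, or equals e if there is none. *)
Lemma noninj_image_eq a b :
  ~ injective a -> ~ injective b -> endo_image a = endo_image b -> a = b.
Proof.
move=> aN bN ab.
have mab f : exists g, a f = b g.
  by apply/endo_imageP; rewrite -ab endo_image_mem.
have mba f : exists g, b f = a g.
  by apply/endo_imageP; rewrite ab endo_image_mem.
have zab : zero_of a = zero_of b.
  have [g ag] := mab (const_transf (pt 0)).
  have [h bh] := mba (const_transf (pt 0)).
  by rewrite -[LHS](zero_ofMl n_ge5 aN h) -bh -[RHS](zero_ofMr n_ge5 b g) -ag.
have eab : a 1 = b 1.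
  have [g ag] := mab 1; have [h bh] := mba 1.
  have <- : a 1 * b 1 = b 1 by rewrite bh -endoM mul1g.
  by rewrite ag -endoM mulg1.
have half c d : ~ injective c -> ~ injective d ->
    endo_image c = endo_image d -> c 1 = d 1 -> zero_of c = zero_of d ->
    odd_of c = odd_of d \/ odd_of c = c 1.
  move=> cN dN cd e1 e0.
  have : odd_of c \in endo_image d by rewrite -cd endo_image_mem.
  rewrite image_noninj // !inE.
  case/orP => [/orP []|] /eqP; [by right; rewrite e1 | by left |].
  move=> tz; right; rewrite -odd_ofX {3}tz -e0.
  by rewrite odd_of_zero // e0.
have tab : odd_of a = odd_of b.
  have [//|ta] := half a b aN bN ab eab zab.
  have [//|tb] := half b a bN aN (esym ab) (esym eab) (esym zab).
  by rewrite ta tb.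
apply/endoP => f.
by rewrite (noninj_endoE f aN) (noninj_endoE f bN) zab eab tab.
Qed.

Lemma mul_noninj_same_rank a b :
  ~ injective b -> rank (a * b) = rank b -> a * b = b.
Proof.
move=> bN rab; apply: noninj_image_eq => //.
  by move=> /rank_inj; rewrite rab => /rank_inj.
by apply/eqP; rewrite eqEcard endo_image_mul_sub -!rankE rab leqnn.
Qed.

Lemma collapse_exists t z :
  t * t * t = t -> t * z = z -> z * t = z -> z * z = z ->
  exists a : endo n, forall f, a f = on_parity f (t * t) t z.
Proof.
move=> ttt tz zt zz.
pose F : {ffun transf n -> transf n} := [ffun f => on_parity f (t * t) t z].
have FM : [forall f : transf n, forall g : transf n, F (f * g) == F f * F g].
  apply/forallP => f; apply/forallP => g; apply/eqP.
  rewrite !ffunE /on_parity parityM.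
  case: (parity f) => [[]|] /=; case: (parity g) => [[]|] //=;
  by rewrite ?mulgA ?ttt -?mulgA ?tz // ?mulgA ?zt ?ttt.
by exists (Endo FM) => f; rewrite ffunE.
Qed.

Lemma collapse_noninj a e t z :
  (forall f, a f = on_parity f e t z) -> ~ injective a.
Proof.
move=> aE aI; have : const_transf (pt 0) = const_transf (pt 1).
  by apply: aI; rewrite !aE /on_parity !parity_noninj //; apply: noninj_const.
by move=> /ffunP/(_ (pt 0)); rewrite !ffunE => /eqP; rewrite point_eq.
Qed.

(** * Essential endomorphisms *)

(** Endomorphisms of rank more than 3 are injective, hence so are their
products. *)
Lemma essential_rank_gt2 a : 2 < rank a -> essential a.
Proof.
move=> a_gt2 aG; have := generated_above aG; rewrite ltnNge => /negP; apply.
suff /rank_inj -> : injective a by [].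
move: aG; apply: (@generated_ind n _ (fun b => injective b)).
  by move=> b; rewrite inE => lt_b; apply/rank_gt3/(leq_trans _ lt_b).
move=> b c; rewrite inE => lt_b cI.
have bI : injective b by apply/rank_gt3/(leq_trans _ lt_b).
by move=> f g; rewrite !endo_mulE => /cI/bI.
Qed.

(** Let a be constant with value e <> 1. An endomorphism c of rank 2 whose
values are all non-injective, followed by the d of rank 2 that sends
permutations to 1 and other maps to e, gives a. *)
Lemma rank1_essential a : rank a = 1%N -> essential a -> forall f, a f = 1.
Proof.
move=> a1 ea; have aE f : a f = a 1.
  apply/eqP; apply: contraTT isT => fg.
  by have : 1 < rank a by [apply/rank_gt1P; exists f, 1]; rewrite a1.
have [e1|/eqP e1] := pselect (a 1 = 1); first by move=> f; rewrite aE.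
case: ea; rewrite a1; pose y := merge_transf (pt 0) (pt 1).
have yy : y * y = y by apply: merge_transf_idem.
have [c cE] : exists c : endo n,
    forall f, c f = on_parity f y y (const_transf (pt 2)).
  have [|||//|c] := @collapse_exists y (const_transf (pt 2)).
  - by rewrite !yy.
  - exact: mul_const_transf.
  - by rewrite const_transfM ffunE.
  - exact: mul_const_transf.
  by rewrite yy => cE; exists c.
have [d dE] : exists d : endo n, forall f, d f = on_parity f 1 1 (a 1).
  have [||||d] := @collapse_exists 1 (a 1); rewrite ?mulg1 ?mul1g ?endoXX //.
  by exists d.
have -> : a = c * d.
  apply/endoP => f; rewrite aE endo_mulE dE /on_parity parity_noninj //.
  rewrite cE /on_parity; case: parity => [b|]; last exact: noninj_const.
  by rewrite if_same; apply: merge_transf_noninj.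
apply: generated_mul; apply: generated_mem; rewrite inE; apply/rank_gt1P.
  exists 1, (const_transf (pt 0)); rewrite !cE /on_parity parity1.
  rewrite parity_noninj; last exact: noninj_const.
  by apply/eqP => /ffunP/(_ (pt 3)); rewrite !ffunE.
exists 1, (const_transf (pt 0)); rewrite !dE /on_parity parity1.
by rewrite parity_noninj 1?eq_sym //; apply: noninj_const.
Qed.

Lemma zero_of_eq1 a : zero_of a = 1 -> forall f, a f = 1.
Proof. by move=> z1 f; rewrite -[LHS]mulg1 -z1 zero_ofMr. Qed.

(** Let c * d be constantly 1. If d is injective, c is constant. If not, then
d (zero_of c) = 1, where zero_of c is an idempotent: either it is 1, and then c
is constantly 1 since c f * 1 = 1 for all f; or it is non-injective, and then
zero_of d = 1 and d is constantly 1. *)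
Lemma const1_essential a : (forall f, a f = 1) -> essential a.
Proof.
move=> a1; have ra := rank_const a1.
move/(@generated_ind n _ (fun b => ~ forall f, b f = 1)); apply=> //.
  move=> b; rewrite inE ra => /rank_gt1P [f [g fg]] b1.
  by rewrite !b1 eqxx in fg.
move=> c d; rewrite inE ra => c_gt1 dN1 cd1.
have {}cd1 f : d (c f) = 1 by rewrite -endo_mulE.
have c_nconst x : ~ (forall f, c f = x).
  by move=> cx; have /rank_gt1P [f [g]] := c_gt1; rewrite !cx eqxx.
have [dI|dN] := pselect (injective d).
  by apply: (c_nconst (c 1)) => f; apply: dI; rewrite !cd1.
have [zI|zN] := pselect (injective (zero_of c)); last first.
  apply/dN1/zero_of_eq1.
  by rewrite -(noninj_endo_singular n_ge5 dN zN) cd1.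
by apply/(c_nconst 1)/zero_of_eq1/inj_idem_transf => //; apply: zero_of_idem.
Qed.

(** The values e and z of d are idempotents, which c sends to c 1 if they are
injective and to zero_of c otherwise; so {c 1, zero_of c} is the image of d * c.
It is also the image of h * c, where h sends odd permutations to an even
involution and non-injective maps to a constant. *)
Lemma rank2_mul_rank3 d c :
  rank d = 2 -> rank c = 3 -> rank (d * c) = 2 -> ~ essential (d * c).
Proof.
move=> rd rc rdc edc.
pose s := tperm (pt 0) (pt 1) * tperm (pt 2) (pt 3).
have dN : ~ injective d by move/rank_gt3; rewrite rd.
have cN : ~ injective c by move/rank_gt3; rewrite rc.
have ss : perm_transf s * perm_transf s = 1.
  have disj : commute (tperm (pt 0) (pt 1)) (tperm (pt 2) (pt 3)).
    by rewrite /commute conjgC tpermJ !tpermD.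
  rewrite -perm_transfM /s {1}disj -mulgA (mulgA (tperm (pt 0) _)) tperm2.
  by rewrite mul1g tperm2 perm_transf1.
have [||||h hE] := @collapse_exists (perm_transf s) (const_transf (pt 4)).
- by rewrite ss mul1g.
- exact: mul_const_transf.
- by rewrite const_transfM ffunE permM !tpermD.
- exact: mul_const_transf.
rewrite {}ss in hE.
have hN := collapse_noninj hE.
have h1 : h 1 = 1 by rewrite hE /on_parity parity1.
have ht : odd_of h = perm_transf s.
  by rewrite [LHS]hE /on_parity parity_perm odd_tperm.
have hz : zero_of h = const_transf (pt 4).
  by rewrite [LHS]hE /on_parity parity_noninj //; apply: noninj_const.
have rh : rank h = 3.
  apply: odd_neq_rank => //; rewrite ht h1; apply/eqP => /ffunP/(_ (pt 0)).
  by rewrite transf1 ffunE permM tpermL tpermD // => /eqP; rewrite point_eq.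
have dc_hc : d * c = h * c.
  apply: noninj_image_eq.
  - by move/rank_gt3; rewrite rdc.
  - by move/rank_gt3; rewrite ltnNge (leq_trans (rank_mull _ _)) ?rh.
  have im_dc : endo_image (d * c) = [set c 1; zero_of c].
    apply/eqP; rewrite eqEcard -rankE rdc cards2 andbC.
    apply/andP; split; first by case: eqP.
    rewrite endo_image_mul image_noninj //.
    have -> : odd_of d = d 1.
      by apply: contraTeq isT => /(odd_neq_rank dN); rewrite rd.
    have idem f : f * f = f -> c f \in [set c 1; zero_of c].
      move=> ff; rewrite !inE; have [fI|fN] := pselect (injective f).
        by rewrite (inj_idem_transf fI ff) eqxx.
      by rewrite (noninj_endo_singular n_ge5 cN fN) eqxx orbT.
    apply/subsetP => _ /imsetP [f fd ->]; apply: idem.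
    move: fd; rewrite !inE orbb => /orP [] /eqP->.
      exact: endoXX.
    exact: zero_of_idem.
  rewrite im_dc endo_image_mul image_noninj // ht h1 hz !imsetU !imset_set1.
  have -> : c (perm_transf s) = c 1.
    by apply: noninj_endo_even => //; rewrite odd_permM !odd_tperm.
  rewrite setUid; congr (_ |: [set _]).
  by apply/esym/noninj_endo_singular => //; apply: noninj_const.
apply: edc; rewrite rdc {1}dc_hc.
by apply: generated_mul; apply: generated_mem; rewrite inE ?rh ?rc.
Qed.

(** If b is an automorphism, a * b lies in the orbit of a. If it is not but has
the rank of a * b, then a * b = b. In the remaining case, by essentiality, a has
the rank of a * b and b a larger one, which is impossible in rank 2 by
[rank2_mul_rank3]; in rank 1, a * b is constantly 1, and so is a because b is
not constant. *)
Lemma essential_mul a b : essential (a * b) ->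
  a * b \in aut_orbit a \/ a * b \in aut_orbit b.
Proof.
move=> eab; have [/autoP [p ->]|bN] := pselect (injective b).
  by left; apply/aut_orbitP; exists p.
have [rb|/eqP rb] := pselect (rank (a * b) = rank b).
  by right; rewrite mul_noninj_same_rank // aut_orbit_refl.
have {}rb : rank (a * b) < rank b by rewrite ltn_neqAle rb rank_mulr.
have ra : rank a = rank (a * b).
  apply/eqP; rewrite eqn_leq rank_mull andbT leqNgt; apply/negP => ra.
  by apply: eab; apply: generated_mul; apply: generated_mem; rewrite inE.
have b3 := rank_noninj bN.
have ab_le2 : rank (a * b) <= 2 by rewrite -ltnS (leq_trans rb).
have [ab1|ab2] : rank (a * b) = 1%N \/ rank (a * b) = 2.
  move: (rank_gt0 (a * b)) ab_le2.
  by case: (rank _) => [|[|[|k]]] //; [left|right].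
  have ab_one := rank1_essential ab1 eab.
  have aN : ~ injective a by move/rank_gt3; rewrite ra ab1.
  have [zI|zN] := pselect (injective (zero_of a)).
    left; suff -> : a * b = a by apply: aut_orbit_refl.
    apply/endoP => f; rewrite ab_one zero_of_eq1 //.
    by apply: inj_idem_transf => //; apply: zero_of_idem.
  move: rb; rewrite ab1 => /rank_gt1P [f [g]].
  have b1 : zero_of b = 1.
    by rewrite -(noninj_endo_singular n_ge5 bN zN) -endo_mulE ab_one.
  by rewrite !(zero_of_eq1 b1) eqxx.
case: (rank2_mul_rank3 _ _ ab2 eab); first by rewrite ra.
by apply/eqP; rewrite eqn_leq b3 -ab2.
Qed.

Lemma essential_generated (S : {set endo n}) a :
  essential a -> generated_by S a -> exists2 b, b \in aut_orbit a & b \in S.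
Proof.
move=> ea Sa; move: Sa ea.
apply: (@generated_ind n S
  (fun a => essential a -> exists2 b, b \in aut_orbit a & b \in S)).
  by move=> b bS _; exists b => //; apply: aut_orbit_refl.
move=> b c bS IH ebc; have [bcb|bcc] := essential_mul ebc.
  by exists b => //; apply: aut_orbit_sym.
have [x xc xS] := IH (essential_orbit (aut_orbit_sym bcc) ebc).
by exists x => //; rewrite (aut_orbit_eq bcc).
Qed.

End Singular.

(** * The automorphism group *)

Lemma card_set2_le (T : finType) (x y : T) : #|[set x; y]| <= 2.
Proof. by rewrite cards2; case: (_ != _). Qed.

Section Automorphisms.
Variable n : nat.
Implicit Types (f g : transf n) (s t : 'S_n) (p q : auto n).

Definition conj_transf s f : transf n := perm_transf s^-1 * f * perm_transf s.

Lemma conj_transfM s : {morph conj_transf s : f g / f * g}.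
Proof.
move=> f g; rewrite /conj_transf !mulgA -(mulgA _ (perm_transf s)).
by rewrite -perm_transfM mulgV perm_transf1 mulg1.
Qed.

Lemma inner_subproof s
    (c := [ffun f => conj_transf s f] : {ffun transf n -> transf n}) :
  [forall f : transf n, forall g : transf n, c (f * g) == c f * c g].
Proof.
by apply/forallP => f; apply/forallP => g; rewrite !ffunE conj_transfM.
Qed.

Definition inner_endo s : endo n := Endo (inner_subproof s).

Lemma inner_inj_subproof s : injectiveb (inner_endo s).
Proof.
apply/injectiveP => f g; rewrite !ffunE /conj_transf => fg; apply/ffunP => i.
have /ffunP/(_ (s i)) := fg; rewrite !transfM !(ffunE (fun i => _ i)) !permK.
exact: perm_inj.
Qed.

Definition inner s : auto n := Auto (inner_inj_subproof s).

Lemma innerE s f : inner s f = perm_transf s^-1 * f * perm_transf s.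
Proof. by rewrite ffunE. Qed.

Lemma inner_const s i : inner s (const_transf i) = const_transf (s i).
Proof. by rewrite innerE mul_const_transf const_transfM ffunE. Qed.

Lemma innerM : {morph inner : s t / s * t}.
Proof.
move=> s t; apply/auto_endo_inj/endoP => f.
by rewrite auto_endoM endo_mulE !innerE invMg !perm_transfM !mulgA.
Qed.
Canonical inner_morphism := Morphism (D := [set: 'S_n]) (in2W innerM).

Lemma const_transf_inj : 0 < n -> injective (@const_transf n).
Proof. by move=> n_gt0 i j /ffunP/(_ (Ordinal n_gt0)); rewrite !ffunE. Qed.

(** The constant maps are the right zeros of T_n, so p permutes them; this
permutation of the points is the one p conjugates by, because f is determined by
its products with constant maps. *)
Lemma inner_surj p : 0 < n -> exists s, p = inner s.
Proof.
move=> n_gt0; pose i0 := Ordinal n_gt0.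
pose F (i : 'I_n) : 'I_n := p (const_transf i) i0.
have FE i : p (const_transf i) = const_transf (F i).
  apply: transf_right_zero => g; have [h ->] := auto_surj p g.
  by rewrite -endoM mul_const_transf.
have FI : injective F.
  move=> i j Fij; apply: (const_transf_inj n_gt0); apply: (@auto_inj n p).
  by rewrite !FE Fij.
exists (perm FI); apply/auto_endo_inj/endoP => f; apply/ffunP => i.
rewrite innerE !transfM !(ffunE (fun i => _ i)).
set j := (perm FI)^-1 i; have -> : i = F j by rewrite -(permE FI) permKV.
rewrite permE; apply: (const_transf_inj n_gt0).
by have := FE (f j); rewrite -const_transfM endoM FE const_transfM.
Qed.

Lemma auto_gen2 : 1 < n ->
  exists2 A : {set auto n}, <<A>> = [set: auto n] & #|A| <= 2.
Proof.
move=> n_gt1.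
have [B genB B2] :
    exists2 B : {set 'S_n}, <<B>> = [set: 'S_n] & #|B| <= 2.
  case: (n) n_gt1 => [|[|m]] // _.
  exists [set tperm (ord0 : 'I_m.+2) (Ordinal (isT : 1 < m.+2));
              perm (GRing.addrI (1%R : 'I_m.+2))].
    apply: gen_tpermn_circular_shift.
    by rewrite /= subn0 modnn modn_small ?coprimen1.
  exact: card_set2_le.
exists (inner @* B); last by rewrite (leq_trans (leq_morphim _ _)).
rewrite -morphim_gen ?subsetT // genB; apply/setP => p; rewrite inE.
by have [s ->] := inner_surj p (ltnW n_gt1); rewrite mem_morphim ?inE.
Qed.

Lemma auto_not_cyclic (A : {set auto n}) :
  2 < n -> <<A>> = [set: auto n] -> 2 <= #|A|.
Proof.
move=> n_gt2 genA; rewrite ltnNge; apply/negP => A1.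
have abA : abelian [set: auto n].
  rewrite -genA abelian_gen; case: (set_0Vmem A) => [->|[p pA]].
    by rewrite -abelian_gen gen0 abelian1.
  suff -> : A = [set p] by rewrite -abelian_gen; apply: cycle_abelian.
  by apply/esym/eqP; rewrite eqEcard sub1set pA cards1.
pose x := Ordinal (ltnW (ltnW n_gt2)); pose y := Ordinal (ltnW n_gt2).
pose z := Ordinal n_gt2.
have : inner (tperm x y) * inner (tperm y z)
     = inner (tperm y z) * inner (tperm x y).
  by apply: (centsP abA); rewrite inE.
move/(congr1 (fun p : auto n => p (const_transf x) x)).
rewrite -!innerM !inner_const !ffunE !permM tpermL tpermL.
rewrite (@tpermD _ y z x) // tpermL.
by move=> /eqP.

Qed.

End Automorphisms.

(** * Generating sets *)

Section Generation.
Variable n : nat.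
Hypothesis n_ge5 : 4 < n.
Implicit Types (a b : endo n) (S : {set endo n}) (p q : auto n).

Lemma essential_orbitsP (O : {set endo n}) :
  O \in essential_orbits n <-> exists a, essential a /\ O = aut_orbit a.
Proof.
split=> [/imsetP [a]|[a [ea ->]]].
  by rewrite inE => /asboolP ea ->; exists a.
by apply/imsetP; exists a; rewrite // inE; apply/asboolP.
Qed.

Lemma generated_auto S (A : {set auto n}) p :
  <<A>> = [set: auto n] ->
  (forall q, q \in A -> generated_by S (auto_endo q)) ->
  generated_by S (auto_endo p).
Proof.
move=> genA AS.
have [q qA] : exists q, q \in A.
  apply/card_gt0P; apply: ltnW; apply: auto_not_cyclic genA.
  exact: leq_trans n_ge5.
(* The empty product is the power of q to its order, a nonempty word. *)
have S1 : generated_by S (auto_endo 1).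
  rewrite -(expg_order q); case: #[q] (order_gt0 q) => // m _.
  elim: m => [|m IH]; first exact: AS.
  by rewrite expgS auto_endoM; apply: generated_mul => //; apply: AS.
have /gen_prodgP [m [c cA ->]] : p \in <<A>> by rewrite genA inE.
elim: m c cA => [|m IH] c cA; first by rewrite big_ord0.
rewrite big_ord_recl auto_endoM; apply: generated_mul; first exact: AS.
by apply: IH => i; apply: cA.
Qed.

(** All factors of an injective product are injective. *)
Lemma generating_autos S : generating S ->
  <<[set p : auto n | auto_endo p \in S]>> = [set: auto n].
Proof.
move=> gS; apply/setP => p; rewrite inE; set A := [set _ | _].
suff : forall q, auto_endo p = auto_endo q -> q \in <<A>> by apply.
move: (gS (auto_endo p)).
apply: (@generated_ind n S (fun a => forall q, a = auto_endo q -> q \in <<A>>)).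
  by move=> a aS q aq; rewrite mem_gen // inE -aq.
move=> a b aS IH q abq.
have /autoP [r ar] : injective a.
  by move=> f g fg; apply: (@auto_inj n q); rewrite -abq !endo_mulE fg.
have bE : b = auto_endo (r^-1 * q).
  by rewrite auto_endoM -abq ar mulgA -auto_endoM mulVg mul1g.
rewrite -(mulKVg r q); apply: groupM; last exact: IH.
by rewrite mem_gen // inE -ar.
Qed.

(** By downward induction on the rank: an inessential endomorphism is a product
of endomorphisms of higher rank, and an essential one is obtained from the
element of its orbit lying in S. *)
Lemma orbits_generate S (A : {set auto n}) :
  <<A>> = [set: auto n] -> (forall q, q \in A -> auto_endo q \in S) ->
  (forall a, ~ injective a -> essential a ->
     exists2 b, b \in aut_orbit a & b \in S) ->
  generating S.
Proof.
move=> genA AS ess_S a.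
have gen_auto p : generated_by S (auto_endo p).
  by apply: generated_auto genA _ => q /AS; apply: generated_mem.
have [m le_m] := ubnP (#|transf n| - rank a).
elim: m a le_m => // m IH a le_m.
have [/autoP [p -> //]|aN] := pselect (injective a).
have [ea|/contrapT ga] := pselect (essential a).
  have [b ba bS] := ess_S a aN ea; have /aut_orbitP [p ->] := aut_orbit_sym ba.
  by apply: generated_mul => //; apply: generated_mem.
apply: generated_trans ga => b; rewrite inE => lt_ab; apply: IH.
rewrite ltnS in le_m; apply: leq_trans le_m; apply: ltn_sub2l => //.
exact: leq_trans lt_ab (rank_max b).
Qed.

Lemma generatingP S :
  generating S <->
  (exists2 A : {set auto n},
     <<A>>%g = [set: auto n] & [set auto_endo p | p in A] \subset S) /\
  (forall O : {set endo n}, O \in essential_orbits n ->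
     exists2 a : endo n, a \in O & a \in S).
Proof.
split=> [gS|[[A genA AS] ess_S]].
  split; last first.
    by move=> O /essential_orbitsP [a [ea ->]]; apply: essential_generated.
  exists [set p : auto n | auto_endo p \in S]; first exact: generating_autos.
  by apply/subsetP => a /imsetP [p]; rewrite inE => pS ->.
apply: (orbits_generate genA) => [q qA|a _ ea].
  by apply: (subsetP AS); apply: imset_f.
by apply: ess_S; apply/essential_orbitsP; exists a.
Qed.

Lemma const1_endo_subproof
    (c := [ffun f => 1] : {ffun transf n -> transf n}) :
  [forall f : transf n, forall g : transf n, c (f * g) == c f * c g].
Proof. by apply/forallP => f; apply/forallP => g; rewrite !ffunE mulg1. Qed.

Definition const1_endo : endo n := Endo const1_endo_subproof.

Lemma const1_endoE f : const1_endo f = 1.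
Proof. by rewrite ffunE. Qed.

Lemma rank_const1 : rank const1_endo = 1%N.
Proof. exact: rank_const const1_endoE. Qed.

(** The essential orbits other than the automorphism group, see
[noninj_orbitsP]. *)
Definition noninj_orbits : {set {set endo n}} :=
  aut_orbit const1_endo
    |: (essential_orbits_of_rank n 3 :|: essential_orbits_of_rank n 2).

Lemma essential_orbits_of_rankP k (O : {set endo n}) :
  reflect (exists a, [/\ rank a = k, essential a & O = aut_orbit a])
          (O \in essential_orbits_of_rank n k).
Proof.
apply: (iffP imsetP) => [[a]|[a [ra ea ->]]].
  by rewrite inE => /andP [/eqP ra /asboolP ea] ->; exists a.
by exists a; rewrite // inE ra eqxx; apply/asboolP.
Qed.

Lemma noninj_orbitsP (O : {set endo n}) :
  O \in noninj_orbits <->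
  exists a, [/\ ~ injective a, essential a & O = aut_orbit a].
Proof.
split.
  case/setU1P => [->|/setUP [] /essential_orbits_of_rankP [a [ra ea ->]]].
  - exists const1_endo; split=> //.
      by move/(rank_gt3 n_ge5); rewrite rank_const1.
    by apply: (const1_essential n_ge5); apply: const1_endoE.
  - by exists a; split=> //; move/(rank_gt3 n_ge5); rewrite ra.
  - by exists a; split=> //; move/(rank_gt3 n_ge5); rewrite ra.
move=> [a [aN ea ->]]; rewrite !inE.
have := rank_noninj n_ge5 aN; have := rank_gt0 a.
case ra: (rank a) => [|[|[|[|k]]]] // _ _.
- suff -> : a = const1_endo by rewrite eqxx.
  by apply/endoP => f; rewrite const1_endoE; apply: (rank1_essential n_ge5).
- by apply/or3P/Or33/essential_orbits_of_rankP; exists a.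
- by apply/or3P/Or32/essential_orbits_of_rankP; exists a.
Qed.

Lemma card_noninj_orbits :
  #|noninj_orbits| =
  1 + #|essential_orbits_of_rank n 3| + #|essential_orbits_of_rank n 2|.
Proof.
have disj a b : aut_orbit a = aut_orbit b -> rank a = rank b.
  by move=> ab; apply: aut_orbit_rank; rewrite -ab aut_orbit_refl.
rewrite cardsU1 cardsU disjoint_setI0 ?cards0 ?subn0 ?addnA.
  rewrite inE negb_or; case: essential_orbits_of_rankP => [[a [ra _ /disj]]|_].
    by rewrite ra rank_const1.
  case: essential_orbits_of_rankP => [[a [ra _ /disj]]|_] //.
  by rewrite ra rank_const1.
apply/pred0P => O; apply/negP => /andP [].
case/essential_orbits_of_rankP => a [ra _ ->].
by case/essential_orbits_of_rankP => b [rb _ /disj]; rewrite ra rb.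
Qed.

(** At least two automorphisms are needed, and the other elements of S must meet
every member of [noninj_orbits]. *)
Lemma generating_card S : generating S ->
  3 + #|essential_orbits_of_rank n 3| + #|essential_orbits_of_rank n 2|
    <= #|S|.
Proof.
move=> gS; pose A := [set p : auto n | auto_endo p \in S].
have A2 : 2 <= #|A|.
  by apply: auto_not_cyclic (generating_autos gS); apply: leq_trans n_ge5.
pose AE := [set auto_endo p | p in A].
have AES : AE \subset S by apply/subsetP => a /imsetP [p]; rewrite inE => pS ->.
rewrite -(cardsID AE S) (setIidPr AES).
rewrite (card_imset _ (@auto_endo_inj n)).
rewrite -addnA -[3]/(2 + 1) -!addnA leq_add // addnA -card_noninj_orbits.
apply: leq_trans (leq_imset_card (@aut_orbit n) _).
apply/subset_leq_card/subsetP => O /noninj_orbitsP [a [aN ea ->]].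
have [b ba bS] := essential_generated n_ge5 ea (gS a).
apply/imsetP; exists b; last by rewrite (aut_orbit_eq ba).
rewrite inE bS andbT; apply/imsetP => -[p _ bp]; apply: aN.
by apply/rank_inj; rewrite -(aut_orbit_rank ba) bp; apply/rank_inj/auto_inj.
Qed.

Lemma small_generating_exists : exists2 S : {set endo n}, generating S &
  #|S| <= 3 + #|essential_orbits_of_rank n 3| + #|essential_orbits_of_rank n 2|.
Proof.
have [|A genA A2] := @auto_gen2 n; first exact: leq_trans n_ge5.
(* Orbits are nonempty, so that a member is always picked. *)
pose rep (O : {set endo n}) := odflt const1_endo [pick a in O].
exists ([set auto_endo p | p in A] :|: rep @: noninj_orbits).
  apply: (orbits_generate genA) => [q qA|a aN ea].
    by rewrite inE imset_f.
  exists (rep (aut_orbit a)).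
    by rewrite /rep; case: pickP => // /(_ a); rewrite aut_orbit_refl.
  by rewrite inE orbC imset_f //; apply/noninj_orbitsP; exists a.
rewrite (leq_trans (leq_card_setU _ _)) // -[3]/(2 + 1) -!addnA leq_add //.
  by rewrite (leq_trans (leq_imset_card _ _)).
by rewrite (leq_trans (leq_imset_card _ _)) // card_noninj_orbits addnA.
Qed.

End Generation.

Theorem proposition4p2 (n : nat) (hn : 5 <= n) :
  [/\ forall S : {set endo n},
        generating S <->
        (exists2 A : {set auto n},
           <<A>>%g = [set: auto n] & [set auto_endo p | p in A] \subset S) /\
        (forall O : {set endo n}, O \in essential_orbits n ->
           exists2 a : endo n, a \in O & a \in S),
      essential_orbits_of_rank n 3 = orbits_of_rank n 3,
      exists2 S : {set endo n}, generating S &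
        #|S| = 3 + #|essential_orbits_of_rank n 3|
                 + #|essential_orbits_of_rank n 2|
    & forall S : {set endo n}, generating S ->
        3 + #|essential_orbits_of_rank n 3|
          + #|essential_orbits_of_rank n 2| <= #|S|].
Proof.
split.
- exact: generatingP.
- apply/setP => O; apply/imsetP/imsetP => -[a]; rewrite inE.
    by case/andP => a3 _ ->; exists a; rewrite ?inE.
  move=> a3 ->; exists a; rewrite // inE a3; apply/asboolP.
  by apply: (essential_rank_gt2 hn); rewrite (eqP a3).
- have [S gS leS] := small_generating_exists hn; exists S => //.
  by apply/eqP; rewrite eqn_leq leS generating_card.
- exact: generating_card.
Qed.
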